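(* For every integer $n\geq 110$ with $n\equiv 26 \pmod{42}$, there exists a planar graph $G$ on $n$ vertices which contains neither $K_4$ nor $C_7$ as a subgraph and satisfies $$e(G)=\frac{18}{7}n-\frac{48}{7}.$$
   Context: All graphs are finite, simple and undirected. $e(G)$ denotes the number of edges of $G$; $K_4$ is the complete graph on $4$ vertices and $C_7$ is the cycle on $7$ vertices. *)

(* Defs.v *)
From HB Require Import structures.
From mathcomp Require Import all_boot all_order all_algebra.
From mathcomp Require Import all_classical all_reals all_analysis.
Import Order.TTheory GRing.Theory Num.Theory.
Import numFieldNormedType.Exports.
Set Implicit Arguments.
Unset Strict Implicit.
Unset Printing Implicit Defensive.

Record sgraph := SGraph {
  svertex :> finType;
  adj : rel svertex;
  adj_sym : symmetric adj;
  adj_irrefl : irreflexive adj }.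

Definition edges (G : sgraph) : {set {set G}} :=
  [set E : {set G} | [exists u, exists v, adj u v && (E == [set u; v]%SET)]]%SET.

(* Not necessarily induced: adjacency is only preserved, not reflected. *)
Definition subgraph (H G : sgraph) : Prop :=
  exists f : H -> G, injective f /\ (forall x y, adj x y -> adj (f x) (f y)).

Definition complete_adj (n : nat) : rel 'I_n := fun i j => i != j.

Fact complete_sym (n : nat) : symmetric (@complete_adj n).
Proof. by move=> i j; rewrite /complete_adj eq_sym. Qed.

Fact complete_irrefl (n : nat) : irreflexive (@complete_adj n).
Proof. by move=> i; rewrite /complete_adj eqxx. Qed.

Definition complete_graph (n : nat) : sgraph :=
  SGraph (@complete_sym n) (@complete_irrefl n).

(* [ordS] is the cyclic successor on ['I_n].  The conjunct [i != j] only
   matters for the degenerate case n = 1; this is the n-cycle for n >= 3. *)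
Definition cycle_adj (n : nat) : rel 'I_n :=
  fun i j => (i != j) && ((j == ordS i) || (i == ordS j)).

Fact cycle_sym (n : nat) : symmetric (@cycle_adj n).
Proof. by move=> i j; rewrite /cycle_adj eq_sym orbC. Qed.

Fact cycle_irrefl (n : nat) : irreflexive (@cycle_adj n).
Proof. by move=> i; rewrite /cycle_adj eqxx. Qed.

Definition cycle_graph (n : nat) : sgraph :=
  SGraph (@cycle_sym n) (@cycle_irrefl n).

Local Open Scope classical_set_scope.
Local Open Scope ring_scope.

Definition arc_between (R : realType) (p q : R * R) (A : set (R * R)) : Prop :=
  exists g : R -> R * R,
    [/\ {within `[0, 1], continuous g}, set_inj `[0, 1] g,
        g 0 = p, g 1 = q & g @` `[0, 1] = A].

(* The last two conditions say that the interior of an edge contains no vertex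
   and no point of another edge. *)
Definition plane_drawing (R : realType) (G : sgraph)
    (pos : G -> R * R) (arc : {set G} -> set (R * R)) : Prop :=
  [/\ injective pos,
      forall u v : G, adj u v ->
        arc_between (pos u) (pos v) (arc [set u; v]%SET),
      forall (E : {set G}) (v : G), E \in edges G ->
        arc E (pos v) -> v \in E
    & forall E F : {set G}, E \in edges G -> F \in edges G -> E != F ->
        arc E `&` arc F `<=` range pos].

Definition planar (R : realType) (G : sgraph) : Prop :=
  exists (pos : G -> R * R) (arc : {set G} -> set (R * R)),
    plane_drawing pos arc.

(* Main.v *)
(* Glue octahedra (12 edges on 6 vertices, no K4) along single vertices.  The octahedra are the
   nodes of the graph formed by the path 0, 1, ..., 3m+1 with the chords 3j -- 3j+7, and two of
   them share a vertex exactly when they are adjacent there.  That graph has girth 8, so a cycle of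
   length at most 7 stays inside one octahedron, which excludes K4 and C7.  It has 4m edges, hence
   the result has n = 6(3m+2) - 4m = 14m+12 vertices and 12(3m+2) = 18n/7 - 48/7 edges.

   It is planar because the path can be drawn as a spiral whose consecutive turns are joined by the
   chords.  Concretely, multiplication by the Gaussian integer -2+i turns by 153.4 degrees, close to
   the 3/7 of a turn that three steps of the path should make, and the drawing is invariant under
   moving by three octahedra and multiplying by -2+i.  Outer triangles of octahedra at most two such
   periods apart are separated by linear arithmetic, the others by their distance to the origin. *)
Require Import Defs.
From HB Require Import structures.
From mathcomp Require Import all_boot all_order all_algebra.
From mathcomp Require Import all_classical all_reals all_analysis.
From mathcomp Require Import zify lra ring.
Import Order.TTheory GRing.Theory Num.Theory.
Import numFieldNormedType.Exports.
Local Open Scope ring_scope.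

(** * Octahedra and their common vertices *)

Definition chord_port (t : nat) : nat := if (t %% 3 == 0)%N then (t + 7)%N else t.

(* Vertex names.  [(0, t)] joins the octahedra [t - 1] and [t] of the path, [(1, t)] is the chord
   port of octahedron [t] (shared with octahedron [t - 7] if [t = 1 mod 3]), and [(k + 2, t)] with
   [k < 3] lies inside octahedron [t].  Vertices number [j] and [j + 3] of [oct t] are opposite. *)
Definition oct (t j : nat) : nat * nat :=
  match j with
  | 0 => (0, t)
  | 1 => (0, t.+1)
  | 2 => (1, chord_port t)
  | _ => (j.-1, t)
  end%N.

Lemma oct_inj t i j : (i < 6)%N -> (j < 6)%N -> oct t i = oct t j -> i = j.
Proof.
by move: i j => [|[|[|[|[|[|i]]]]]] [|[|[|[|[|[|j]]]]]] //= _ _ []; rewrite ?/chord_port; lia.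
Qed.

Lemma oct_contact s t i j :
  s != t -> (i < 6)%N -> (j < 6)%N -> oct s i = oct t j ->
  [\/ t = s.+1 /\ oct s i = (0, s.+1)%N,
      s = t.+1 /\ oct s i = (0, s)%N,
      [/\ (s %% 3 = 0)%N, t = (s + 7)%N & oct s i = (1, s + 7)%N]
    | [/\ (t %% 3 = 0)%N, s = (t + 7)%N & oct s i = (1, s)%N]].
Proof.
move: i j => [|[|[|[|[|[|i]]]]]] [|[|[|[|[|[|j]]]]]] //= /eqP st _ _ [];
  rewrite ?/chord_port; try lia.
- by move=> E; constructor 2; rewrite E.
- by move=> E; constructor 1; rewrite E.
- do 2 case: eqP => ?; move=> E; try lia.
  + by constructor 3; split => //.
  + by constructor 4; split => //; congr (_, _); lia.
Qed.

(** * Girth of the graph of octahedra *)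

Definition block_nbrs (t : nat) : seq (nat * (nat * nat)) :=
  [:: (t.+1, (0, t.+1)); (t.-1, (0, t))]%N ++
  (if t %% 3 == 0 then [:: (t + 7, (1, t + 7))] else [::])%N ++
  (if t %% 3 == 1 then [:: (t - 7, (1, t))] else [::])%N.

(* No closed trail of length at most [k] more extends the trail from [s] to [t] through the contacts
   [used], except for the empty one.  The truncated subtractions in [block_nbrs] are harmless as
   long as [7 * k <= t]. *)
Fixpoint no_short_trail (k s t : nat) (used : seq (nat * nat)) : bool :=
  ((t == s) ==> nilp used) &&
  if k is k'.+1 then
    all (fun p => (p.2 \in used) || no_short_trail k' s p.1 (p.2 :: used))
      (block_nbrs t)
  else true.

Lemma no_short_trailS k s t used :
  no_short_trail k.+1 s t used =
  ((t == s) ==> nilp used) &&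
  all (fun p => (p.2 \in used) || no_short_trail k s p.1 (p.2 :: used)) (block_nbrs t).
Proof. by []. Qed.

Definition shift (u : nat) (c : nat * nat) : nat * nat := (c.1, c.2 + u)%N.

Lemma shift_inj u : injective (shift u).
Proof. by move=> [a b] [c d] [-> /eqP]; rewrite eqn_add2r => /eqP ->. Qed.

Lemma block_nbrs_shift u t : (7 <= t)%N ->
  block_nbrs (t + 3 * u) =
    [seq ((p.1 + 3 * u)%N, shift (3 * u) p.2) | p <- block_nbrs t].
Proof.
move=> t7; rewrite /block_nbrs /shift.
have -> : ((t + 3 * u) %% 3 = t %% 3)%N by lia.
case: eqP => [->|_] /=; last case: eqP => /= _; rewrite ?cats0.
all: by do ![congr (_ :: _)]; do ![congr (_, _)]; lia.
Qed.

(** The chord pattern has period 3, and a step descends by at most 7, so under [7 * k <= t] no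
    subtraction truncates. *)
Lemma no_short_trail_shift u k s t used : (7 * k <= t)%N ->
  no_short_trail k (s + 3 * u) (t + 3 * u) (map (shift (3 * u)) used)
  = no_short_trail k s t used.
Proof.
elim: k t used => [|k IHk] t used kt.
  by rewrite /= eqn_add2r /nilp size_map.
rewrite !no_short_trailS eqn_add2r /nilp size_map block_nbrs_shift ?all_map; last lia.
congr (_ && _); apply: eq_in_all => p p_nbr /=.
rewrite (mem_map (@shift_inj _)) -IHk //.
have /allP/(_ _ p_nbr) /= : all (fun q => t - 7 <= q.1)%N (block_nbrs t).
  by rewrite /block_nbrs /=; do 2 case: ifP => _ /=; lia.
by lia.
Qed.

(** By periodicity only the starts 60, 61 and 62 remain, and these are settled by computation. The
    offset 60 is a multiple of 3 exceeding [7 * 7]. *)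
Lemma no_short_trail7 t : no_short_trail 7 (t + 60) (t + 60) [::].
Proof.
have -> : (t + 60 = 60 + t %% 3 + 3 * (t %/ 3))%N by lia.
rewrite -[[::]]/(map (shift (3 * (t %/ 3))) [::]) no_short_trail_shift; last lia.
have : (t %% 3 < 3)%N by rewrite ltn_mod.
by case: (t %% 3)%N => [|[|[|]]] // _; vm_compute.
Qed.

Definition in_block (t : nat) (x : nat * nat) : Prop :=
  exists2 i, (i < 6)%N & x = oct t i.

Lemma contact_nbr s t c : s != t -> in_block s c -> in_block t c ->
  ((t + 60)%N, shift 60 c) \in block_nbrs (s + 60).
Proof.
move=> st [i i6 ->] [j j6] /(oct_contact _ _ _ _ st i6 j6).
rewrite /block_nbrs /shift.
case=> [[-> ->]|[-> ->]|[s0 -> ->]|[t0 -> ->]] /=; rewrite !(inE, mem_cat).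
- by rewrite addSn eqxx.
- by rewrite addSn eqxx orbT.
- have -> : ((s + 60) %% 3 = 0)%N by lia.
  rewrite /= inE.
  by rewrite (_ : s + 7 + 60 = s + 60 + 7)%N ?eqxx ?orbT //; lia.
- have -> : ((t + 7 + 60) %% 3 = 1)%N by lia.
  rewrite /= inE.
  by rewrite (_ : t + 7 + 60 - 7 = t + 60)%N ?eqxx ?orbT //; lia.
Qed.

(** A step with [l i = l i.+1] is dropped; any other is a step of a trail, and distinctness of the
    [c i] keeps contacts from being reused. The conclusion [used = [::]] drives the induction: after
    a genuine step it is absurd, so there is none. *)
Lemma closed_trail_const n k s (l : nat -> nat) (c : nat -> nat * nat) used :
  (n <= k)%N -> no_short_trail k s (l 0%N + 60) used ->
  (forall i, (i < n)%N -> in_block (l i) (c i) /\ in_block (l i.+1) (c i)) ->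
  (forall i j, (i < n)%N -> (j < n)%N -> c i = c j -> i = j) ->
  (forall i, (i < n)%N -> shift 60 (c i) \notin used) ->
  (l n + 60 = s)%N ->
  used = [::] /\ (forall i, (i <= n)%N -> l i = l 0%N).
Proof.
elim: n k l c used => [|n IHn] k l c used nk ok lc c_inj c_used ls.
  split; last by case.
  by case: k ok {nk} => [|k] /=; rewrite ls eqxx /= => /andP[/nilP].
have [c0 c1] := lc 0%N isT.
have lc' i : (i < n)%N -> in_block (l i.+1) (c i.+1) /\ in_block (l i.+2) (c i.+1).
  by move=> ni; apply: lc.
have inj' i j : (i < n)%N -> (j < n)%N -> c i.+1 = c j.+1 -> i = j.
  by move=> ni nj /c_inj -/(_ ni nj) [].
have [E|l01] := eqVneq (l 0%N) (l 1%N).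
  have := IHn k (l \o S) (c \o S) used (ltnW nk).
  rewrite /= -E => /(_ ok lc' inj' (fun i => c_used i.+1) ls) [-> lE].
  by split=> // -[|i] // ni; rewrite lE.
case: k nk ok => // k nk.
rewrite no_short_trailS => /andP[_ /allP /(_ _ (contact_nbr _ _ _ l01 c0 c1))] /=.
rewrite (negPf (c_used 0%N isT)) => ok.
have c_used' i : (i < n)%N -> shift 60 (c i.+1) \notin shift 60 (c 0%N) :: used.
  move=> ni; rewrite inE negb_or c_used // andbT.
  by apply/eqP => /shift_inj /c_inj -/(_ ni isT).
by have [] := IHn k (l \o S) (c \o S) _ nk ok lc' inj' c_used' ls.
Qed.

(* Consecutive blocks share exactly one vertex, so the blocks met along the cycle form a closed
   trail in the graph of blocks, which has girth 8. *)
Lemma short_cycle_in_block k (v : nat -> nat * nat) (l : nat -> nat) :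
  (0 < k <= 7)%N ->
  (forall i j, (i < k)%N -> (j < k)%N -> v i = v j -> i = j) ->
  v k = v 0%N ->
  (forall i, (i < k)%N -> in_block (l i) (v i) /\ in_block (l i) (v i.+1)) ->
  forall i, (i < k)%N -> l i = l 0%N.
Proof.
move=> /andP[k0 k7] v_inj vk lv.
(* This closes the list up with [l' k = l 0]; the octahedra [l' i] and [l' i.+1] both contain
   [v i.+1]. *)
pose l' i := if (i < k)%N then l i else l 0%N.
have [] := closed_trail_const k 7 (l 0%N + 60) l' (v \o S) [::] k7.
- by rewrite /l' k0; exact: no_short_trail7.
- move=> i ik /=; rewrite /l' ik; split; first by case: (lv _ ik).
  case: ltnP => ki; first by case: (lv _ ki).
  by rewrite (_ : i.+1 = k) ?vk; [case: (lv _ k0)|lia].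
- move=> i j ik jk /=.
  have [Ei|ni] := eqVneq i.+1 k; have [Ej|nj] := eqVneq j.+1 k.
  + by lia.
  + by rewrite Ei vk => /v_inj; lia.
  + by rewrite Ej vk => /v_inj; lia.
  + by move/v_inj; lia.
- by [].
- by rewrite /l' ltnn.
move=> _ lE i ik; have := lE i (ltnW ik).
by rewrite /l' ik k0.
Qed.

(** * The spiral of outer triangles *)

(* Multiplication by the Gaussian integer [-2 + i]. *)
Definition spiral {R : realType} (p : R * R) : R * R :=
  (- 2 * p.1 - p.2, p.1 - 2 * p.2).

(* The outer triangles of the first three octahedra, in the order of the ports of [oct]; found by
   a computer search. *)
Definition tri_base {R : realType} (r k : nat) : R * R :=
  match r, k with
  | 0%N, 0%N => (1, 1)
  | 0%N, 1%N => (0, 2)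
  | 0%N, _ => (1, 7)
  | 1%N, 0%N => (0, 2)
  | 1%N, 1%N => (- 2, 2)
  | 1%N, _ => (- 1, 1)
  | _, 0%N => (- 2, 2)
  | _, 1%N => (- 3, - 1)
  | _, _ => (- 2, - 1)
  end.

Definition bpoint {R : realType} (T : nat -> R * R) (w : nat -> R) : R * R :=
  (w 0%N * (T 0%N).1 + w 1%N * (T 1%N).1 + w 2%N * (T 2%N).1,
   w 0%N * (T 0%N).2 + w 1%N * (T 1%N).2 + w 2%N * (T 2%N).2).

Definition weights {R : realType} (w : nat -> R) : Prop :=
  [/\ 0 <= w 0%N, 0 <= w 1%N, 0 <= w 2%N & w 0%N + w 1%N + w 2%N = 1].

Definition sqnorm {R : realType} (p : R * R) : R := p.1 ^+ 2 + p.2 ^+ 2.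

Definition is_vertex {R : realType} (k : nat) (w : nat -> R) : Prop :=
  forall k', (k' < 3)%N -> w k' = (k == k')%:R.

Lemma tri_base_nondegenerate (R : realType) (r : nat) (w w' : nat -> R) :
  (r < 3)%N -> weights w -> weights w' ->
  bpoint (tri_base r) w = bpoint (tri_base r) w' ->
  forall k, (k < 3)%N -> w k = w' k.
Proof.
move=> r3 [_ _ _ w1] [_ _ _ w1'].
rewrite /bpoint; case: r r3 => [|[|[|//]]] _ /= [E1 E2] [|[|[|//]]] _; lra.
Qed.

(** For each pair of triangles the equations are linear in the weights: they are infeasible, or they
    force the one common corner. *)
Lemma tri_base_disjoint (R : realType) (r r' d : nat) (w w' : nat -> R) :
  (r < 3)%N -> (r' < 3)%N -> (d < 3)%N -> (r < r' + 3 * d)%N ->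
  weights w -> weights w' ->
  bpoint (tri_base r) w =
    bpoint (fun k => iter d (spiral) (tri_base r' k)) w' ->
  exists k k', [/\ (k < 3)%N, (k' < 3)%N, is_vertex k w, is_vertex k' w'
    & oct r k = oct (r' + 3 * d) k'].
Proof.
move=> r3 r3' d3 lt_rr' [wa wb wc w1] [wa' wb' wc' w1'].
have vert k : (k < 3)%N -> 1 <= w k -> is_vertex k w.
  by case: k => [|[|[|//]]] _ ? [|[|[|//]]] _ /=; lra.
have vert' k : (k < 3)%N -> 1 <= w' k -> is_vertex k w'.
  by case: k => [|[|[|//]]] _ ? [|[|[|//]]] _ /=; lra.
rewrite /bpoint; case: d d3 lt_rr' => [|[|[|//]]] _;
case: r r3 => [|[|[|//]]] _; case: r' r3' => [|[|[|//]]] _ //= _ [E1 E2];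
(* Disjoint triangles, neighbours on the path (port 1 meets port 0), or ends of a chord (port 2
   meets port 2). *)
first [by exfalso; lra
  |by exists 1%N, 0%N; split=> //; [apply: vert|apply: vert'] => //; lra
  |by exists 2%N, 2%N; split=> //; [apply: vert|apply: vert'] => //; lra].
Qed.

Lemma spiral_inj (R : realType) : injective (@spiral R).
Proof.
move=> [a b] [c d] [/= E1 E2]; congr (_, _); lra.
Qed.

Lemma bpoint_spiral (R : realType) n (T : nat -> R * R) w :
  bpoint (fun k => iter n spiral (T k)) w = iter n spiral (bpoint T w).
Proof.
elim: n => [//|n IHn] /=; rewrite -IHn /bpoint /spiral /=; congr (_, _); ring.
Qed.

Lemma sqnorm_spiral (R : realType) n (p : R * R) :
  sqnorm (iter n spiral p) = 5 ^+ n * sqnorm p.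
Proof.
elim: n => [|n IHn]; first by rewrite expr0 mul1r.
by rewrite exprS -mulrA -IHn iterS /sqnorm /spiral /=; ring.
Qed.

(* Three periods multiply [sqnorm] by 125, which exceeds the ratio of these bounds. *)
Lemma tri_base_sqnorm (R : realType) (r : nat) (w : nat -> R) :
  (r < 3)%N -> weights w -> 2 <= sqnorm (bpoint (tri_base r) w) <= 58.
Proof.
move=> r3 [wa wb wc w1]; rewrite /sqnorm /bpoint /=.
set x := (X in X ^+ 2 + _); set y := (X in _ + X ^+ 2).
have [x3 y7] : -3 <= x <= 3 /\ -7 <= y <= 7.
  by rewrite /x /y; clear x y; case: r r3 => [|[|[|//]]] _ /=; lra.
(* Each triangle lies in a half-plane at distance at least the square root of 2 from the origin. *)
have far : [\/ 2 <= x + y, 2 <= y - x | x <= -2].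
  rewrite /x /y; clear x y x3 y7; case: r r3 => [|[|[|//]]] _ /=.
  - by constructor 1; lra.
  - by constructor 2; lra.
  - by constructor 3; lra.
move: x3 y7 => /andP[? ?] /andP[? ?]; apply/andP; split; last first.
  have : 0 <= (x + 3) * (3 - x) by apply: mulr_ge0; lra.
  have : 0 <= (y + 7) * (7 - y) by apply: mulr_ge0; lra.
  by lra.
case: far => ?.
- have : 0 <= (x + y - 2) * (x + y + 2) by apply: mulr_ge0; lra.
  by have := sqr_ge0 (x - y); lra.
- have : 0 <= (y - x - 2) * (y - x + 2) by apply: mulr_ge0; lra.
  by have := sqr_ge0 (x + y); lra.
- have : 0 <= (- 2 - x) * (2 - x) by apply: mulr_ge0; lra.
  by have := sqr_ge0 y; lra.
Qed.

Definition corner {R : realType} (t k : nat) : R * R :=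
  iter (t %/ 3) spiral (tri_base (t %% 3) k).

Lemma iter_inj (T : Type) (f : T -> T) n : injective f -> injective (iter n f).
Proof. by move=> f_inj; elim: n => [//|n IHn] x y /= /f_inj /IHn. Qed.

Lemma corner_nondegenerate (R : realType) t (w w' : nat -> R) :
  weights w -> weights w' -> bpoint (corner t) w = bpoint (corner t) w' ->
  forall k, (k < 3)%N -> w k = w' k.
Proof.
move=> ww ww'; rewrite !bpoint_spiral => /(iter_inj _ _ _ (spiral_inj R)).
by apply: tri_base_nondegenerate; rewrite ?ltn_mod.
Qed.

Lemma oct_shift s t k : oct (s + 3 * t) k = shift (3 * t) (oct s k).
Proof.
rewrite /shift; case: k => [|[|[|k]]] //=; congr (_, _); rewrite /chord_port.
have -> : ((s + 3 * t) %% 3 = s %% 3)%N by lia.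
by case: ifP => _; lia.
Qed.

(** Cancelling the periods common to [s] and [t] leaves a gap of [d] periods: [tri_base_disjoint]
    covers [d < 3], the norm bounds the rest. *)
Lemma corner_disjoint_lt (R : realType) s t (w w' : nat -> R) : (s < t)%N ->
  weights w -> weights w' -> bpoint (corner s) w = bpoint (corner t) w' ->
  exists k k', [/\ (k < 3)%N, (k' < 3)%N, is_vertex k w, is_vertex k' w'
    & oct s k = oct t k'].
Proof.
move=> st ww ww'.
have r3 := ltn_mod s 3; have r3' := ltn_mod t 3.
pose d := (t %/ 3 - s %/ 3)%N.
have t3 : (t %/ 3 = s %/ 3 + d)%N by rewrite /d; lia.
rewrite /corner t3 !bpoint_spiral iterD => /(iter_inj _ _ _ (spiral_inj R)) E.
have [d3|d3] := ltnP d 3.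
  rewrite -bpoint_spiral in E.
  have lt_st : (s %% 3 < t %% 3 + 3 * d)%N by lia.
  have [k [k' [k3 k3' wk wk' Ek]]] := tri_base_disjoint _ _ _ _ _ _ r3 r3' d3 lt_st ww ww' E.
  exists k, k'; split=> //.
  have -> : s = (s %% 3 + 3 * (s %/ 3))%N by lia.
  have -> : t = (t %% 3 + 3 * d + 3 * (s %/ 3))%N by lia.
  by rewrite [LHS]oct_shift [RHS]oct_shift Ek.
exfalso.
have /andP[_] := tri_base_sqnorm _ _ _ r3 ww.
have /andP[lo _] := tri_base_sqnorm _ _ _ r3' ww'.
rewrite E sqnorm_spiral => hi.
have : 5 ^+ 3 <= 5 ^+ d :> R by rewrite ler_eXn2l // ltr1n.
by nra.
Qed.

Lemma corner_disjoint (R : realType) s t (w w' : nat -> R) : s != t ->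
  weights w -> weights w' -> bpoint (corner s) w = bpoint (corner t) w' ->
  exists k k', [/\ (k < 3)%N, (k' < 3)%N, is_vertex k w, is_vertex k' w'
    & oct s k = oct t k'].
Proof.
rewrite neq_ltn => /orP[st|ts] ww ww' E; first exact: corner_disjoint_lt.
have [k [k' [k3 k3' wk wk' Ek]]] := corner_disjoint_lt _ _ _ _ _ ts ww' ww (esym E).
by exists k', k; split.
Qed.

(** * Straight-line drawing of the octahedra *)

(* Barycentric coordinates of vertex [j] of an octahedron in its outer triangle. *)
Definition bary {R : realType} (j k : nat) : R :=
  if (j < 3)%N then (j == k)%:R else if (j == k + 3)%N then 1 / 5 else 2 / 5.

Lemma bary_weights (R : realType) j : (j < 6)%N -> weights (@bary R j).
Proof.
by rewrite /weights /bary; case: j => [|[|[|[|[|[|//]]]]]] _ /=; split; lra.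
Qed.

Lemma bary_inj (R : realType) i j : (i < 6)%N -> (j < 6)%N ->
  (forall k, (k < 3)%N -> @bary R i k = bary j k) -> i = j.
Proof.
move=> i6 j6 E; move: (E 0%N isT) (E 1%N isT) (E 2%N isT) => {E}; rewrite /bary.
case: i i6 => [|[|[|[|[|[|//]]]]]] _; case: j j6 => [|[|[|[|[|[|//]]]]]] _ //=;
  by move=> E0 E1 E2; exfalso; lra.
Qed.

(** A shared vertex is placed by the octahedron whose number it bears; [place_oct] shows that the
    other one agrees. The [k.+1] undoes the [j.-1] in [oct]. *)
Definition place {R : realType} (x : nat * nat) : R * R :=
  match x.1 with
  | 0%N => corner x.2 0
  | 1%N => corner x.2 2
  | k => bpoint (corner x.2) (bary k.+1)
  end.

Lemma bpoint_vertex (R : realType) (T : nat -> R * R) k w :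
  (k < 3)%N -> is_vertex k w -> bpoint T w = T k.
Proof.
move=> k3 wk; rewrite /bpoint !wk // [RHS]surjective_pairing.
by case: k k3 {wk} => [|[|[|//]]] _ /=; congr (_, _); ring.
Qed.

Lemma cornerE (R : realType) q r k : (r < 3)%N ->
  corner (3 * q + r) k = iter q spiral (@tri_base R r k).
Proof.
move=> r3; rewrite /corner.
have -> : ((3 * q + r) %/ 3 = q)%N by lia.
by have -> : ((3 * q + r) %% 3 = r)%N by lia.
Qed.

Lemma corner_next (R : realType) t : @corner R t.+1 0 = corner t 1.
Proof.
have -> : t = (3 * (t %/ 3) + t %% 3)%N by lia.
move: (t %/ 3)%N (t %% 3)%N (ltn_mod t 3) => q [|[|[|//]]] _.
- by rewrite -addnS !cornerE.
- by rewrite -addnS !cornerE.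
(* A new period starts here: [spiral] maps [(1, 1)] to [(- 3, - 1)]. *)
rewrite (_ : (3 * q + 2).+1 = 3 * q.+1 + 0)%N; last by lia.
rewrite !cornerE // iterSr; congr (iter q spiral _).
by rewrite /spiral /=; congr (_, _); ring.
Qed.

(** Seven steps are two periods and one triangle, and [spiral] applied twice maps [(- 1, 1)] to
    [(1, 7)]. *)
Lemma corner_chord (R : realType) t : @corner R (chord_port t) 2 = corner t 2.
Proof.
rewrite /chord_port; case: eqP => // t3.
have -> : t = (3 * (t %/ 3) + 0)%N by lia.
rewrite (_ : 3 * _ + 0 + 7 = 3 * (t %/ 3).+2 + 1)%N; last by lia.
rewrite !cornerE // !iterSr; congr (iter _ spiral _).
by rewrite /spiral /=; congr (_, _); ring.
Qed.

Lemma place_oct (R : realType) t j : (j < 6)%N ->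
  place (oct t j) = bpoint (corner t) (@bary R j).
Proof.
have vert k : (k < 3)%N -> is_vertex k (@bary R k).
  by move=> k3 k' _; rewrite /bary k3.
have [j3 _|] := ltnP j 3; last by case: j => [|[|[|[|[|[|//]]]]]].
rewrite (bpoint_vertex _ _ _ _ j3 (vert _ j3)).
case: j j3 => [|[|[|//]]] _; rewrite /place /=.
- by [].
- exact: corner_next.
- exact: corner_chord.
Qed.

(** For fixed edges this is linear in [r] and [r']. Taking [r] strictly inside and [r'] in the
    closed interval treats crossings and vertices on edges together. *)
Lemma octahedron_edges_disjoint (R : realType) (i j i' j' : nat) (r r' : R) :
  (i < j < 6)%N -> (i' < j' < 6)%N ->
  (i %% 3 != j %% 3)%N -> (i' %% 3 != j' %% 3)%N ->
  0 < r < 1 -> 0 <= r' <= 1 ->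
  (forall k, (k < 3)%N -> (1 - r) * @bary R i k + r * @bary R j k =
    (1 - r') * @bary R i' k + r' * @bary R j' k) ->
  i = i' /\ j = j'.
Proof.
move=> ij ij' nij nij' /andP[r0 r1] /andP[r0' r1'] E.
move: (E 0%N isT) (E 1%N isT) (E 2%N isT) => {E}.
rewrite /bary.
move: i j i' j' ij ij' nij nij' => [|[|[|[|[|[|i]]]]]] [|[|[|[|[|[|j]]]]]] // + + + + /=;
move=> [|[|[|[|[|[|i']]]]]] [|[|[|[|[|[|j']]]]]] //= ij ij' _ _ E0 E1 E2;
  by [split | exfalso; lra | lia].
Qed.

Definition seg_point {R : realType} (p q : R * R) (r : R) : R * R :=
  ((1 - r) * p.1 + r * q.1, (1 - r) * p.2 + r * q.2).

Definition seg_bary {R : realType} (i j : nat) (r : R) (k : nat) : R :=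
  (1 - r) * bary i k + r * bary j k.

Lemma seg_point_place (R : realType) t i j (r : R) : (i < 6)%N -> (j < 6)%N ->
  seg_point (place (oct t i)) (place (oct t j)) r =
  bpoint (corner t) (seg_bary i j r).
Proof.
move=> i6 j6; rewrite !place_oct // /seg_point /bpoint /seg_bary /=.
by congr (_, _); ring.
Qed.

Lemma seg_bary_weights (R : realType) i j (r : R) : (i < 6)%N -> (j < 6)%N ->
  0 <= r <= 1 -> weights (seg_bary i j r).
Proof.
move=> i6 j6 /andP[r0 r1].
have [a0 a1 a2 aE] := bary_weights R i i6; have [b0 b1 b2 bE] := bary_weights R j j6.
have r1' : 0 <= 1 - r by lra.
rewrite /seg_bary; split; try by rewrite addr_ge0 ?mulr_ge0.
rewrite -[RHS](_ : (1 - r) * (bary i 0 + bary i 1 + bary i 2) +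
  r * (bary j 0 + bary j 1 + bary j 2) = 1); last by rewrite aE bE; ring.
by ring.
Qed.

Lemma seg_bary_vertex (R : realType) i j k (r : R) :
  (i < j < 6)%N -> (i %% 3 != j %% 3)%N -> (k < 6)%N -> 0 <= r <= 1 ->
  (forall k', (k' < 3)%N -> seg_bary i j r k' = bary k k') ->
  k = i \/ k = j.
Proof.
move=> ij nij k6 /andP[r0 r1] E.
have /andP[ltij j6] := ij; have i6 := ltn_trans ltij j6.
have [r00|rn0] := eqVneq r 0.
  left; apply/esym/(bary_inj R) => // k' k3.
  by rewrite -E // /seg_bary r00; ring.
have [r11|rn1] := eqVneq r 1.
  right; apply/esym/(bary_inj R) => // k' k3.
  by rewrite -E // /seg_bary r11; ring.
have r01 : 0 < r < 1 by rewrite !lt_neqAle eq_sym rn0 rn1 r0 r1.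
(* The vertex [k] is viewed as the start of the edge from [k] to [k.+1], or for [k = 5] as the end
   of the edge from 4 to 5. *)
have [k5|k5] := ltnP k 5.
  left; have [k65 nk] : (k < k.+1 < 6)%N /\ (k %% 3 != k.+1 %% 3)%N by lia.
  have r' : 0 <= (0 : R) <= 1 by rewrite lexx ler01.
  have [k' k3|-> //] := octahedron_edges_disjoint R i j k k.+1 r 0 ij k65 nij nk r01 r'.
  by rewrite -/(seg_bary i j r k') E //; ring.
right; have r' : 0 <= (1 : R) <= 1 by rewrite lexx ler01.
have [k' k3|_ ->] := octahedron_edges_disjoint R i j 4 5 r 1 ij isT nij isT r01 r'.
  by rewrite -/(seg_bary i j r k') E // (_ : k = 5)%N; [ring|lia].
by lia.
Qed.

Lemma seg_point_vertex (R : realType) s t i j k (r : R) :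
  (i < j < 6)%N -> (i %% 3 != j %% 3)%N -> (k < 6)%N -> 0 <= r <= 1 ->
  seg_point (place (oct s i)) (place (oct s j)) r = place (oct t k) ->
  oct t k = oct s i \/ oct t k = oct s j.
Proof.
move=> ij nij k6 r01; have /andP[ltij j6] := ij; have i6 := ltn_trans ltij j6.
rewrite seg_point_place // place_oct // => E.
have ww := seg_bary_weights R i j r i6 j6 r01; have wk := bary_weights R k k6.
have [st|st] := eqVneq s t.
  rewrite -st in E *.
  have := seg_bary_vertex _ _ _ _ _ ij nij k6 r01 (corner_nondegenerate _ _ _ _ ww wk E).
  by case=> ->; [left|right].
(* Distinct triangles meet only in a common corner, so the question moves into octahedron [s]. *)
have [k1 [k2 [k13 k23 w1 w2 E12]]] := corner_disjoint _ _ _ _ _ st ww wk E.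
have k16 : (k1 < 6)%N by lia. have k26 : (k2 < 6)%N by lia.
have Ek : k = k2.
  by apply: (bary_inj R) => // k' k3; rewrite w2 // /bary k23.
rewrite Ek -E12.
have : forall k', (k' < 3)%N -> seg_bary i j r k' = bary k1 k'.
  by move=> k' k3; rewrite w1 // /bary k13.
by move=> /(seg_bary_vertex _ _ _ _ _ ij nij k16 r01)[] ->; [left|right].
Qed.

Lemma place_inj (R : realType) s t i j : (i < 6)%N -> (j < 6)%N ->
  @place R (oct s i) = place (oct t j) -> oct s i = oct t j.
Proof.
move=> i6 j6; rewrite !place_oct // => E.
have wi := bary_weights R i i6; have wj := bary_weights R j j6.
have [st|st] := eqVneq s t.
  rewrite -st in E *.
  by rewrite (bary_inj R i j i6 j6 (corner_nondegenerate _ _ _ _ wi wj E)).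
have [k1 [k2 [k13 k23 w1 w2 E12]]] := corner_disjoint _ _ _ _ _ st wi wj E.
have -> : i = k1.
  apply: (bary_inj R) => // [|k' k3]; first by lia.
  by rewrite w1 // /bary k13.
have -> : j = k2.
  apply: (bary_inj R) => // [|k' k3]; first by lia.
  by rewrite w2 // /bary k23.
by [].
Qed.

(** An interior point of an edge lies on no other edge of its octahedron, and different outer
    triangles meet only in corners. *)
Lemma seg_point_disjoint (R : realType) s t i j i' j' (r r' : R) :
  (i < j < 6)%N -> (i %% 3 != j %% 3)%N -> 
  (i' < j' < 6)%N -> (i' %% 3 != j' %% 3)%N ->
  0 <= r <= 1 -> 0 <= r' <= 1 ->
  seg_point (place (oct s i)) (place (oct s j)) r =
  seg_point (place (oct t i')) (place (oct t j')) r' ->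
  [/\ s = t, i = i' & j = j'] \/
  exists2 k, (k < 6)%N & seg_point (place (oct s i)) (place (oct s j)) r = place (oct s k).
Proof.
move=> ij nij ij' nij' r01 r01'.
have /andP[ltij j6] := ij; have i6 := ltn_trans ltij j6.
have /andP[ltij' j6'] := ij'; have i6' := ltn_trans ltij' j6'.
have [r00|rn0] := eqVneq r 0.
  right; exists i => //; rewrite r00 /seg_point [RHS]surjective_pairing.
  by congr (_, _); ring.
have [r11|rn1] := eqVneq r 1.
  right; exists j => //; rewrite r11 /seg_point [RHS]surjective_pairing.
  by congr (_, _); ring.
have r01s : 0 < r < 1.
  by move: r01 => /andP[r0 r1]; rewrite !lt_neqAle eq_sym rn0 rn1 r0 r1.
rewrite !seg_point_place // => E.
have ww := seg_bary_weights R i j r i6 j6 r01.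
have ww' := seg_bary_weights R i' j' r' i6' j6' r01'.
have [st|st] := eqVneq s t.
  left; rewrite -st in E.
  by have [] := octahedron_edges_disjoint R i j i' j' r r' ij ij' nij nij' r01s r01'
    (corner_nondegenerate _ _ _ _ ww ww' E).
right; have [k [_ [k3 _ wk _ _]]] := corner_disjoint _ _ _ _ _ st ww ww' E.
have k6 : (k < 6)%N by lia.
exists k => //; rewrite place_oct //.
by rewrite !(bpoint_vertex _ _ _ _ k3) // => k' _; rewrite /bary k3.
Qed.

(** * The chain of octahedra as a graph *)

Definition vert (m : nat) : finType :=
  ('I_(3 * m + 3) + 'I_(m + 3) + 'I_m + 'I_3 * 'I_(3 * m + 2))%type.

(** No chord port has a number divisible by 3. The largest number is [3 * m + 7 = 3 * (m + 2) + 1],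
    from octahedron [3 * m]; hence the [m + 3] in [vert]. *)
Definition label (m : nat) (x : vert m) : nat * nat :=
  match x with
  | inl (inl (inl i)) => (0, i : nat)
  | inl (inl (inr i)) => (1, 3 * i + 1)
  | inl (inr i) => (1, 3 * i + 2)
  | inr (k, t) => (k.+2, t : nat)
  end%N.

Lemma card_vert m : #|vert m| = (14 * m + 12)%N.
Proof. by rewrite !card_sum card_prod !card_ord; lia. Qed.

Lemma label_inj m : injective (@label m).
Proof.
move=> [[[i|i]|i]|[k i]] [[[j|j]|j]|[k' j]] //= [] E; try lia.
- by do 3 congr inl; apply: val_inj.
- by do 2 congr inl; congr inr; apply: val_inj; rewrite /=; lia.
- by congr (inl (inr _)); apply: val_inj; rewrite /=; lia.
- by move=> E'; congr (inr (_, _)); apply: val_inj.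
Qed.

Lemma label_oct m t j : (t < 3 * m + 2)%N -> (j < 6)%N ->
  {x : vert m | label m x = oct t j}.
Proof.
move=> tm j6.
have [j0|] := eqVneq j 0%N.
  have i3 : (t < 3 * m + 3)%N by lia.
  by exists (inl (inl (inl (Ordinal i3)))); rewrite j0.
have [j1|] := eqVneq j 1%N.
  have i3 : (t.+1 < 3 * m + 3)%N by lia.
  by exists (inl (inl (inl (Ordinal i3)))); rewrite j1.
have [j2|] := eqVneq j 2%N.
  rewrite j2 /= /chord_port.
  have [t2|t2] := eqVneq (t %% 3)%N 2%N.
    have i3 : (t %/ 3 < m)%N by lia.
    exists (inl (inr (Ordinal i3))) => /=; case: eqP => ?; congr (_, _); lia.
  pose i := (if t %% 3 == 0 then t %/ 3 + 2 else t %/ 3)%N.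
  have i3 : (i < m + 3)%N by rewrite /i; case: ifP => _; lia.
  exists (inl (inl (inr (Ordinal i3)))) => /=; rewrite /i.
  by case: eqP => ?; congr (_, _); lia.
move=> n2 n1 n0; have k3 : (j - 3 < 3)%N by lia.
exists (inr (Ordinal k3, Ordinal tm)).
by case: j n2 n1 n0 k3 {j6} => [|[|[|j]]] //= _ _ _ _; congr (_, _); lia.
Qed.

(** The octahedron is the complete tripartite graph whose parts are the opposite pairs, that is, the
    residue classes modulo 3. *)
Definition block_adj (t : nat) (x y : nat * nat) : bool :=
  [exists i : 'I_6, exists j : 'I_6,
    [&& x == oct t i, y == oct t j & (i %% 3 != j %% 3)%N]].

Definition chain_adj (m : nat) : rel (vert m) := fun x y =>
  [exists t : 'I_(3 * m + 2), block_adj t (label m x) (label m y)].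

Lemma block_adjP t x y :
  reflect (exists i j, [/\ (i < 6)%N, (j < 6)%N, (i %% 3 != j %% 3)%N,
    x = oct t i & y = oct t j]) (block_adj t x y).
Proof.
apply: (iffP existsP) => [[i /existsP[j /and3P[/eqP-> /eqP-> ij]]]|].
  by exists i, j; split.
move=> [i [j [i6 j6 ij -> ->]]].
by exists (Ordinal i6); apply/existsP; exists (Ordinal j6); rewrite !eqxx.
Qed.

Lemma chain_adjP m x y :
  reflect (exists2 t, (t < 3 * m + 2)%N & block_adj t (label m x) (label m y))
    (chain_adj m x y).
Proof.
apply: (iffP existsP) => [[t xy]|[t tm xy]]; first by exists t.
by exists (Ordinal tm).
Qed.

Lemma block_adj_sym t x y : block_adj t x y -> block_adj t y x.
Proof.
move=> /block_adjP[i [j [i6 j6 ij xi yj]]].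
by apply/block_adjP; exists j, i; rewrite eq_sym.
Qed.

Fact chain_sym m : symmetric (chain_adj m).
Proof.
by move=> x y; apply/chain_adjP/chain_adjP => -[t tm /block_adj_sym]; exists t.
Qed.

Lemma block_adj_irrefl t x : block_adj t x x = false.
Proof.
apply/block_adjP => -[i [j [i6 j6 ij -> /(oct_inj _ _ _ i6 j6)]]].
by move: ij => /[swap] ->; rewrite eqxx.
Qed.

Fact chain_irrefl m : irreflexive (chain_adj m).
Proof. by move=> x; apply/chain_adjP => -[t _]; rewrite block_adj_irrefl. Qed.

Definition octahedron_chain (m : nat) : sgraph :=
  SGraph (chain_sym m) (chain_irrefl m).

Lemma block_adj_in t x y : block_adj t x y -> in_block t x /\ in_block t y.
Proof.
by move=> /block_adjP[i [j [i6 j6 _ -> ->]]]; split; [exists i|exists j].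
Qed.

(** * Exclusion of [C_7] and [K_4] *)

Lemma chain_C7_free m : ~ subgraph (cycle_graph 7) (octahedron_chain m).
Proof.
move=> [f [f_inj f_adj]].
(* Reduction modulo 7 makes [v 7 = v 0] hold by computation. *)
pose v i : nat * nat := label m (f (inord (i %% 7))).
have step i : exists t, (i < 7)%N -> in_block t (v i) /\ in_block t (v i.+1).
  have [i7|] := ltnP i 7; last by exists 0%N.
  have : @adj (cycle_graph 7) (inord (i %% 7)) (inord (i.+1 %% 7)).
    rewrite /= /cycle_adj -!val_eqE /= !inordK ?ltn_pmod // (modn_small i7) eqxx.
    by rewrite orTb andbT; case: i i7 => [|[|[|[|[|[|[|]]]]]]].
  by move/f_adj/chain_adjP => [t _ /block_adj_in]; exists t.
have [l lP] := choice step.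
have v_inj i j : (i < 7)%N -> (j < 7)%N -> v i = v j -> i = j.
  move=> i7 j7 /label_inj /f_inj /(congr1 val) /=.
  by rewrite !inordK ?ltn_pmod // !modn_small.
have lE := short_cycle_in_block 7 v l isT v_inj erefl lP.
have jP (i : 'I_7) : exists j : 'I_6, v i = oct (l 0%N) j.
  have [[j j6 ->] _] := lP _ (ltn_ord i).
  by exists (Ordinal j6); rewrite lE.
have [j jE] := choice jP.
(* Seven distinct vertices would fit into one octahedron, which has six. *)
have /leq_card : injective j.
  by move=> a b ab; apply/val_inj/v_inj => //=; have := jE a; rewrite ab -jE.
by rewrite !card_ord.
Qed.

Lemma block_triangle t1 t2 t3 x y z :
  block_adj t1 x y -> block_adj t2 y z -> block_adj t3 z x -> t1 = t2 /\ t1 = t3.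
Proof.
move=> xy yz zx.
have neq t a b : block_adj t a b -> a <> b.
  by move=> ab E; move: ab; rewrite E block_adj_irrefl.
(* The value [l 2] is the default [t3]. *)
pose v i := nth x [:: x; y; z; x] i; pose l i := nth t3 [:: t1; t2] i.
have v_inj i j : (i < 3)%N -> (j < 3)%N -> v i = v j -> i = j.
  have := (neq _ _ _ xy, neq _ _ _ yz, neq _ _ _ zx).
  by case: i j => [|[|[|]]] [|[|[|]]] //= [[? ?] ?] _ _; rewrite /v /= => ?; exfalso; auto.
have lv i : (i < 3)%N -> in_block (l i) (v i) /\ in_block (l i) (v i.+1).
  by case: i => [|[|[|]]] // _; apply: block_adj_in.
have lE := short_cycle_in_block 3 v l isT v_inj erefl lv.
by split; apply/esym; [apply: (lE 1%N)|apply: (lE 2%N)].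
Qed.

(** Triangles with common edges put all six edges into one octahedron, where four vertices cannot
    lie in distinct classes modulo 3. *)
Lemma chain_K4_free m : ~ subgraph (complete_graph 4) (octahedron_chain m).
Proof.
move=> [f [f_inj f_adj]].
pose v i : nat * nat := label m (f (inord i)).
have e i j : (i < 4)%N -> (j < 4)%N -> i != j -> exists t, block_adj t (v i) (v j).
  move=> i4 j4 ij.
  have : @adj (complete_graph 4) (inord i) (inord j).
    by rewrite /= /complete_adj -val_eqE /= !inordK.
  by move/f_adj/chain_adjP => [t _]; exists t.
have [t b01] := e 0 1 isT isT isT.
have [t02 b02] := e 0 2 isT isT isT.
have [t03 b03] := e 0 3 isT isT isT.
have [t12 b12] := e 1 2 isT isT isT.
have [t13 b13] := e 1 3 isT isT isT.
have [t23 b23] := e 2 3 isT isT isT.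
have [E1 E2] := block_triangle _ _ _ _ _ _ b01 b12 (block_adj_sym _ _ _ b02).
have [E3 E4] := block_triangle _ _ _ _ _ _ b01 b13 (block_adj_sym _ _ _ b03).
have [E5 _] := block_triangle _ _ _ _ _ _ b02 b23 (block_adj_sym _ _ _ b03).
move: b02 b03 b12 b13 b23; rewrite -E5 -E1 -E2 -E3 -E4 => b02 b03 b12 b13 b23.
have [[i0 i06 v0] [i1 i16 v1]] := block_adj_in _ _ _ b01.
have [[i2 i26 v2] [i3 i36 v3]] := block_adj_in _ _ _ b23.
have mod_neq i j : (i < 6)%N -> (j < 6)%N -> block_adj t (oct t i) (oct t j) ->
    (i %% 3 != j %% 3)%N.
  move=> i6 j6 /block_adjP[i' [j' [i6' j6' ij]]].
  by move=> /(oct_inj _ _ _ i6 i6') -> /(oct_inj _ _ _ j6 j6') ->.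
rewrite v0 v1 in b01; rewrite v0 v2 in b02; rewrite v0 v3 in b03.
rewrite v1 v2 in b12; rewrite v1 v3 in b13; rewrite v2 v3 in b23.
move: (mod_neq _ _ i06 i16 b01) (mod_neq _ _ i06 i26 b02) (mod_neq _ _ i06 i36 b03).
move: (mod_neq _ _ i16 i26 b12) (mod_neq _ _ i16 i36 b13) (mod_neq _ _ i26 i36 b23).
by lia.
Qed.

(** * Counting edges *)

Lemma set2_eq (T : finType) (a b c d : T) :
  [set a; b]%SET = [set c; d]%SET -> (a = c /\ b = d) \/ (a = d /\ b = c).
Proof.
move=> E.
have := set21 a b; have := set22 a b; rewrite E !inE.
have := set21 c d; have := set22 c d; rewrite -E !inE.
do 4 case/orP => /eqP ?; subst; auto.
Qed.

(** The difference of [s] and [t], 1 or 7, decides the case of [oct_contact] and with it the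
    vertex. *)
Lemma block_inter s t x y : s != t ->
  in_block s x -> in_block t x -> in_block s y -> in_block t y -> x = y.
Proof.
move=> st [i i6 ->] [j j6 E] [i' i6' ->] [j' j6' E'].
have := oct_contact _ _ _ _ st i6 j6 E; have := oct_contact _ _ _ _ st i6' j6' E'.
by move=> [[? ->]|[? ->]|[? ? ->]|[? ? ->]] [[? ->]|[? ->]|[? ? ->]|[? ? ->]] //; lia.
Qed.

Definition oct_vertex m (t : 'I_(3 * m + 2)) (j : 'I_6) : vert m :=
  sval (label_oct m t j (ltn_ord t) (ltn_ord j)).

Lemma label_oct_vertex m t j : label m (oct_vertex m t j) = oct t j.
Proof. exact: svalP (label_oct m t j _ _). Qed.

Definition octahedron_edges : {set 'I_6 * 'I_6} :=
  [set p : 'I_6 * 'I_6 | (p.1 < p.2)%N && (p.1 %% 3 != p.2 %% 3)%N]%SET.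

Lemma card_octahedron_edges : #|octahedron_edges| = 12%N.
Proof.
rewrite cardsE -sum1_card big_mkcond /=.
rewrite -(pair_bigA _ (fun i j : 'I_6 => if (i < j)%N && (i %% 3 != j %% 3)%N then 1 else 0)%N) /=.
by rewrite !(big_ord_recl, big_ord0).
Qed.

Lemma edge_in_block m (E : {set octahedron_chain m}) :
  reflect (exists (t : 'I_(3 * m + 2)) (i j : 'I_6), [/\ (i < j)%N, (i %% 3 != j %% 3)%N
      & E = [set oct_vertex m t i; oct_vertex m t j]%SET])
    (E \in edges (octahedron_chain m)).
Proof.
rewrite inE; apply: (iffP existsP) => [[u /existsP[v /andP[uv /eqP->]]]|].
  have /chain_adjP[t tm /block_adjP[i [j [i6 j6 ij ui vj]]]] := uv.
  have uE : u = oct_vertex m (Ordinal tm) (Ordinal i6).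
    by apply: label_inj; rewrite label_oct_vertex.
  have vE : v = oct_vertex m (Ordinal tm) (Ordinal j6).
    by apply: label_inj; rewrite label_oct_vertex.
  rewrite {}uE {}vE.
  have [lt_ij|lt_ji|E'] := ltngtP i j; last by rewrite E' eqxx in ij.
    by exists (Ordinal tm), (Ordinal i6), (Ordinal j6).
  by exists (Ordinal tm), (Ordinal j6), (Ordinal i6); rewrite eq_sym finset.setUC.
move=> [t [i [j [lt_ij ij ->]]]].
exists (oct_vertex m t i); apply/existsP; exists (oct_vertex m t j).
rewrite eqxx andbT; apply/chain_adjP; exists t => //.
by apply/block_adjP; exists i, j; rewrite !label_oct_vertex.
Qed.

(** Each octahedron has 12 edges, and none is counted twice because two octahedra share at most one
    vertex. *)
Lemma card_chain_edges m : #|edges (octahedron_chain m)| = (12 * (3 * m + 2))%N.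
Proof.
pose F (p : 'I_(3 * m + 2) * ('I_6 * 'I_6)) : {set octahedron_chain m} :=
  [set oct_vertex m p.1 p.2.1; oct_vertex m p.1 p.2.2]%SET.
have -> : edges (octahedron_chain m) =
    [set F p | p in finset.setX [set: 'I_(3 * m + 2)] octahedron_edges]%SET.
  apply/setP => E; apply/edge_in_block/imsetP.
    move=> [t [i [j [lt_ij ij ->]]]].
    by exists (t, (i, j)); rewrite // !inE /= lt_ij.
  move=> [[t [i j]]]; rewrite !inE /= => /andP[lt_ij ij] ->.
  by exists t, i, j.
rewrite card_in_imset; first by rewrite cardsX cardsT card_ord card_octahedron_edges mulnC.
move=> [s [i j]] [t [i' j']]; rewrite !inE /= => /andP[lt_ij ij] /andP[lt_ij' ij'].
move=> /set2_eq EF.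
have {EF} EF : (oct s i = oct t i' /\ oct s j = oct t j') \/
    (oct s i = oct t j' /\ oct s j = oct t i').
  by case: EF => -[/(congr1 (label m)) + /(congr1 (label m))];
    rewrite !label_oct_vertex => E1 E2; [left|right].
have st : s = t.
  apply/val_inj/eqP; apply: contraT => /= st.
  have in_s (k : 'I_6) : in_block s (oct s k) by exists k.
  have in_t (k : 'I_6) : in_block t (oct t k) by exists k.
  have : oct s i = oct s j.
    by apply: (block_inter _ _ _ _ st) => //; case: EF => -[E1 E2]; rewrite ?E1 ?E2.
  by move/(oct_inj _ _ _ (ltn_ord i) (ltn_ord j)) => E; rewrite E ltnn in lt_ij.
subst t.
case: EF => -[/oct_inj E1 /oct_inj E2].
  by congr (_, (_, _)); apply: val_inj; [apply: E1|apply: E2]; apply: ltn_ord.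
have := E1 (ltn_ord i) (ltn_ord j'); have := E2 (ltn_ord j) (ltn_ord i'); lia.
Qed.

(** * Arcs and planarity *)

Local Open Scope classical_set_scope.

Lemma seg_pointC (R : realType) (p q : R * R) r :
  seg_point p q r = seg_point q p (1 - r).
Proof. by rewrite /seg_point; congr (_, _); ring. Qed.

Lemma seg_point_arc (R : realType) (p q : R * R) : p <> q ->
  arc_between p q [set seg_point p q r | r in `[0, 1]].
Proof.
move=> pq; exists (seg_point p q); split => //.
- have lin (a b : R) : continuous (fun r : R => (1 - r) * a + r * b).
    move=> x.
    have cb : r * b @[r --> x] --> x * b by apply: cvgMl; exact: cvg_id.
    have ca : (1 - r) * a @[r --> x] --> (1 - x) * a.
      by apply: cvgMl; apply: cvgB; [exact: cvg_cst|exact: cvg_id].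
    exact: (cvgD ca cb).
  by apply: continuous_subspaceT => x; exact: (cvg_pair (lin _ _ x) (lin _ _ x)).
(* Coordinatewise, the equations say that [r - r'] times [p - q] vanishes. *)
- move=> r r' _ _ [E1 E2]; apply/eqP; rewrite -subr_eq0; apply/negP => /negP rr'.
  apply: pq; rewrite [p]surjective_pairing [q]surjective_pairing.
  by congr (_, _); apply/eqP; rewrite -subr_eq0 -(mulrI_eq0 _ (mulfI rr')); apply/eqP; lra.
- by rewrite /seg_point [RHS]surjective_pairing; congr (_, _); ring.
- by rewrite /seg_point [RHS]surjective_pairing; congr (_, _); ring.
Qed.

(** Arcs are indexed by unordered pairs, so the segment is described through all ways of writing [E]
    as an edge of an octahedron. *)
Definition chain_arc (R : realType) m (E : {set octahedron_chain m}) : set (R * R) :=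
  [set p | exists (t : 'I_(3 * m + 2)) (i j : 'I_6) (r : R),
    [/\ (i < j)%N, (i %% 3 != j %% 3)%N,
      E = [set oct_vertex m t i; oct_vertex m t j]%SET, 0 <= r <= 1
      & p = seg_point (place (oct t i)) (place (oct t j)) r]].

Lemma chain_arc_edge (R : realType) m (u v : octahedron_chain m) : adj u v ->
  chain_arc R m [set u; v]%SET =
  [set seg_point (place (label m u)) (place (label m v)) r | r in `[0, 1]].
Proof.
move=> uv.
have : [set u; v]%SET \in edges (octahedron_chain m).
  by rewrite inE; apply/existsP; exists u; apply/existsP; exists v; rewrite uv /=.
move=> /edge_in_block[t [i [j [lt_ij ij E]]]].
have r01C (r : R) : 0 <= r <= 1 -> 0 <= 1 - r <= 1 by lra.
apply/seteqP; split=> [p [t' [i' [j' [r [_ _ E' r01 ->]]]]]|p [r]].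
  rewrite /= -!label_oct_vertex.
  have [[-> ->]|[-> ->]] := set2_eq _ _ _ _ _ E'; first by exists r => //; rewrite /= in_itv.
  by exists (1 - r); rewrite /= ?in_itv /= ?r01C // seg_pointC; congr seg_point; ring.
rewrite /= in_itv /= => r01 <-.
have [[-> ->]|[-> ->]] := set2_eq _ _ _ _ _ E; rewrite !label_oct_vertex.
  exists t, i, j, r; split=> //.
exists t, i, j, (1 - r); split=> //; first exact: finset.setUC.
  exact: r01C.
exact: seg_pointC.
Qed.

(** The octahedron may lie beyond the end of the chain; this is harmless, as the drawing is defined
    for all [t]. *)
Lemma label_in_block m (x : vert m) : exists t j, (j < 6)%N /\ label m x = oct t j.
Proof.
case: x => [[[i|i]|i]|[k t]].
- by exists i, 0%N.
- by exists (3 * i + 1)%N, 2%N; split=> //; rewrite /= /chord_port; case: eqP => //; lia.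
- by exists (3 * i + 2)%N, 2%N; split=> //; rewrite /= /chord_port; case: eqP => //; lia.
- by exists t, k.+3; split; first by have := ltn_ord k; lia.
Qed.

Lemma chain_planar (R : realType) m : planar R (octahedron_chain m).
Proof.
pose pos (x : octahedron_chain m) : R * R := place (label m x).
have pos_inj : injective pos.
  move=> x y; rewrite /pos.
  have [s [i [i6 xi]]] := label_in_block m x; have [t [j [j6 yj]]] := label_in_block m y.
  by rewrite xi yj => /(place_inj _ _ _ _ _ i6 j6) E; apply: label_inj; rewrite xi yj.
exists pos, (chain_arc R m); split=> //.
- move=> u v uv; rewrite chain_arc_edge //; apply: seg_point_arc => /pos_inj E.
  by rewrite E adj_irrefl in uv.
- move=> E v _ [t [i [j [r [lt_ij ij -> r01]]]]].
  have [s [k [k6 vk]]] := label_in_block m v.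
  rewrite /pos vk => /esym E'.
  have ltj : (i < j < 6)%N by rewrite lt_ij ltn_ord.
  have [] := seg_point_vertex _ _ _ _ _ _ _ ltj ij k6 r01 E'; rewrite -vk => vE.
    by rewrite (_ : v = oct_vertex m t i) ?set21 //; apply: label_inj; rewrite label_oct_vertex.
  by rewrite (_ : v = oct_vertex m t j) ?set22 //; apply: label_inj; rewrite label_oct_vertex.
move=> E F _ _ EF p [[s [i [j [r [lt_ij ij Es r01 pE]]]]]].
move=> [t [i' [j' [r' [lt_ij' ij' Et r01' pE']]]]].
have ltj : (i < j < 6)%N by rewrite lt_ij ltn_ord.
have ltj' : (i' < j' < 6)%N by rewrite lt_ij' ltn_ord.
have := seg_point_disjoint R s t i j i' j' r r' ltj ij ltj' ij' r01 r01' (etrans (esym pE) pE').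
case=> [[/val_inj st /val_inj ii /val_inj jj]|[k k6]].
  by rewrite Es Et st ii jj eqxx in EF.
rewrite -pE => ->; have [x xk] := label_oct m s k (ltn_ord s) k6.
by exists x => //; rewrite /pos xk.
Qed.

Theorem theorem3 (R : realType) (n : nat) (n_ge110 : (110 <= n)%N)
    (n_mod42 : n = 26 %[mod 42]) :
  exists G : sgraph,
    [/\ #|G| = n,
        planar R G,
        ~ subgraph (complete_graph 4) G,
        ~ subgraph (cycle_graph 7) G
      & (#|edges G|)%:R = 18%:R / 7%:R * n%:R - 48%:R / 7%:R :> rat].
Proof.
(* Here [42 = 3 * 14] and [26 = 14 + 12]. *)
have [m nE] : exists m, n = (14 * m + 12)%N by exists ((n - 12) %/ 14)%N; lia.
exists (octahedron_chain m); split.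
- by rewrite card_vert nE.
- exact: chain_planar.
- exact: chain_K4_free.
- exact: chain_C7_free.
- by rewrite card_chain_edges nE !(natrD, natrM); field.
Qed.
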